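(* Let $G$ be a graph with vertex set $V=\{v_1,\ldots,v_n\}$ and singular Seidel matrix $S$, and let $\phi=\phi(S)=(\phi_1,\dots,\phi_n)$. Then for all $1\le i,j\le n$ the following hold: (i) $\phi_i-\phi_j\equiv 2(d(v_i)-d(v_j)) \pmod 4$; (ii) if $G$ is an even graph, then $\phi_i-\phi_j\equiv 2(d(v_i)-d(v_j)) \pmod 8$.
   Context: All graphs are simple, undirected, finite, with at least one vertex. $d(v)$ denotes the degree of a vertex $v$ in $G$; a graph is called even if every vertex has even degree. For a graph $G$ with vertices $v_1,\dots,v_n$ and adjacency matrix $A$, the Seidel matrix of $G$ is $S=J_n-I_n-2A$, where $J_n$ is the all-ones $n\times n$ matrix and $I_n$ the identity. It is known that $\operatorname{rank} S\ge n-1$ always. Hence, when $S$ is singular, its nullspace is one-dimensional, and $\phi=\phi(G)=\phi(S)$ denotes the unique integer vector $\phi\in\mathbb{Z}^n$ with $S\phi=0$, with the greatest common divisor of its entries equal to $1$, and with first non-zero entry positive. *)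

(* Defs.v *)
From HB Require Import structures.
From mathcomp Require Import all_boot all_order all_algebra.

Set Implicit Arguments.
Unset Strict Implicit.
Unset Printing Implicit Defensive.

Import Order.TTheory GRing.Theory Num.Theory.
Local Open Scope ring_scope.

Definition simple_graph (n : nat) (e : rel 'I_n) : Prop :=
  symmetric e /\ irreflexive e.

Definition degree (n : nat) (e : rel 'I_n) (v : 'I_n) : nat :=
  #|[set w | e v w]|.

Definition even_graph (n : nat) (e : rel 'I_n) : Prop :=
  forall v : 'I_n, ~~ odd (degree e v).

Definition adjacency_mx (n : nat) (e : rel 'I_n) : 'M[int]_n :=
  \matrix_(i, j) (e i j)%:R.

Definition seidel_mx (n : nat) (e : rel 'I_n) : 'M[int]_n :=
  const_mx 1 - 1%:M - 2 *: adjacency_mx e.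

(* The gcd condition rules out phi = 0, so a first non-zero entry exists; when
   the nullspace of S is a line, exactly one phi satisfies the three conditions. *)
Definition is_phi (n : nat) (S : 'M[int]_n) (phi : 'cV[int]_n) : Prop :=
  [/\ S *m phi = 0,
      \big[gcdn/0%N]_(i < n) `|phi i 0%R|%N = 1%N
    & forall i : 'I_n, phi i 0 != 0 ->
        (forall j : 'I_n, (j < i)%N -> phi j 0 = 0) -> 0 < phi i 0].

(* Main.v *)
(** Row [i] of [S phi = 0] reads [phi_i = sigma - 2 (A phi)_i], where [sigma] is
    the sum of the entries of [phi].  Hence all entries have the parity of
    [sigma], and they are odd because their gcd is [1].  Moreover, if all
    entries are congruent to [c] modulo [m], then [(A phi)_i] is [c d(v_i)]
    modulo [m], so that [phi_i - phi_j = -2 c (d(v_i) - d(v_j))] modulo [2 m].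
    Applying this with [m = 2], [c = 1] gives (i); for an even graph (i) makes
    the entries congruent modulo [4], and [m = 4], [c = phi_j] gives (ii). *)
Require Import Defs.
From HB Require Import structures.
From mathcomp Require Import all_boot all_order all_algebra.
From mathcomp Require Import zify ring.

Set Implicit Arguments.
Unset Strict Implicit.
Unset Printing Implicit Defensive.

Import Order.TTheory GRing.Theory Num.Theory.
Local Open Scope ring_scope.

Section SeidelKernel.

Variables (n : nat) (e : rel 'I_n) (phi : 'cV[int]_n).
Hypothesis Sphi0 : seidel_mx e *m phi = 0.

Lemma seidel_kernel_entry (i : 'I_n) :
  phi i 0 = \sum_k phi k 0 - 2 * (adjacency_mx e *m phi) i 0.
Proof.
move/matrixP/(_ i 0): Sphi0.
rewrite /seidel_mx !mulmxBl mul1mx -scalemxAl !mxE.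
under eq_bigr do rewrite mxE mul1r.
by rewrite addrAC => /eqP; rewrite subr_eq0 => /eqP <-.
Qed.

Lemma sum_adjacency_row (i : 'I_n) :
  \sum_k adjacency_mx e i k = (degree e i)%:Z.
Proof.
under eq_bigr do rewrite mxE.
rewrite -natr_sum natz /degree -sum1dep_card [in RHS]big_mkcond.
by congr Posz; apply: eq_bigr => k _; case: (e i k).
Qed.

Lemma dvdz_adjacency_mul (m c : int) (i : 'I_n) :
  (forall k, (m %| phi k 0%R - c)%Z) ->
  (m %| (adjacency_mx e *m phi) i 0%R - c * (degree e i)%:Z)%Z.
Proof.
move=> phi_c; rewrite mxE -sum_adjacency_row mulr_sumr -sumrB.
apply: rpred_sum => k _.
by rewrite [c * _]mulrC -mulrBr dvdz_mull.
Qed.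

(** The sum of the entries cancels between rows [i] and [j]; the factor 2 in front of [A phi]
    doubles the modulus. *)
Lemma seidel_kernel_lift (m c : int) (i j : 'I_n) :
  (forall k, (m %| phi k 0%R - c)%Z) ->
  (2 * m %| phi i 0%R - phi j 0%R
            + 2 * c * ((degree e i)%:Z - (degree e j)%:Z))%Z.
Proof.
move=> phi_c; have di := dvdz_adjacency_mul i phi_c.
have dj := dvdz_adjacency_mul j phi_c.
rewrite (seidel_kernel_entry i) (seidel_kernel_entry j).
set ai := (_ *m _) i 0 in di *; set aj := (_ *m _) j 0 in dj *.
have -> : \sum_k phi k 0 - 2 * ai - (\sum_k phi k 0 - 2 * aj)
    + 2 * c * ((degree e i)%:Z - (degree e j)%:Z)
  = 2 * ((aj - c * (degree e j)%:Z) - (ai - c * (degree e i)%:Z)) by ring.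
by rewrite dvdz_mul2l // rpredB.
Qed.

Lemma seidel_kernel_odd :
  \big[gcdn/0%N]_(i < n) `|phi i 0%R|%N = 1%N ->
  forall k, (2 %| phi k 0%R - 1)%Z.
Proof.
move=> gcd1 k.
have phiE := seidel_kernel_entry.
have [s_even|] := boolP (2 %| \sum_k phi k 0%R)%Z; last first.
  by have := phiE k; lia.
(* An even sum would make every entry even, against gcd 1. *)
suff : (2 %| \big[gcdn/0%N]_(i < n) `|phi i 0%R|)%N by rewrite gcd1.
by apply/dvdn_biggcdP => i _; have := phiE i; lia.
Qed.

End SeidelKernel.

Theorem theorem3p2 (n : nat) (n_gt0 : (0 < n)%N) (e : rel 'I_n)
    (graph_e : simple_graph e)
    (singular_S : \det (seidel_mx e) = 0)
    (phi : 'cV[int]_n) (phiP : is_phi (seidel_mx e) phi) (i j : 'I_n) :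
  (phi i 0%R - phi j 0%R
     = 2 * ((degree e i)%:Z - (degree e j)%:Z) %[mod 4])%Z
  /\ (even_graph e ->
      (phi i 0%R - phi j 0%R
         = 2 * ((degree e i)%:Z - (degree e j)%:Z) %[mod 8])%Z).
Proof.
have [Sphi0 gcd1 _] := phiP.
have phi_odd := seidel_kernel_odd Sphi0 gcd1.
have mod4 k l := seidel_kernel_lift Sphi0 k l phi_odd.
(* The sign is harmless: 2 and -2 agree modulo 4. *)
split=> [|even_e]; first by have := mod4 i j; lia.
(* Even degrees make twice their difference vanish modulo 4. *)
have phi_j k : (4 %| phi k 0%R - phi j 0%R)%Z.
  by have := (mod4 k j, even_e k, even_e j); case; case; lia.
have := seidel_kernel_lift Sphi0 i j phi_j.
have /dvdzP[x Ex] := phi_odd j.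
have [y Ey] : exists y, (degree e i)%:Z - (degree e j)%:Z = 2 * y.
  exists ((degree e i)./2%:Z - (degree e j)./2%:Z).
  by have := (even_e i, even_e j); case; lia.
have {Ex} -> : phi j 0 = 1 + 2 * x by lia.
rewrite {}Ey => /dvdzP[z Ez].
(* [Ez] gives [phi_i - phi_j = 8 z - 4 y (1 + 2 x)]; subtracting [4 y], twice the degree difference,
   leaves [8 (z - y - x y)]. *)
apply/eqP; rewrite eqz_mod_dvd; apply/dvdzP; exists (z - y - x * y).
by lia.
Qed.
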